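(* Let $(G,\cdot,\triangleleft)$ be a shalgebra, let $\overline{k}=(k_1,\ldots,k_\ell)$ be an ordered partition $n=k_1+\cdots+k_\ell$ with all $k_j\ge 1$, and let $\overline{g}\in G^{\overline{k}}=G^{k_1}\times\cdots\times G^{k_\ell}$. Endow the generalized prism $\Delta^{\overline{k}}=\Delta^{k_1}\times\cdots\times\Delta^{k_\ell}$ with the good $G$-labeling of its edges determined by $\overline{g}$. Then the boundary of the $G$-labeled generalized prism $(\overline{g},\Delta^{\overline{k}})$ consists of the $(n-1)$-dimensional labeled cells $$(d_{j;i}(\overline{g}),\ \Delta^{\overline{k}-1_j}),\qquad j=1,\ldots,\ell,\quad i=0,1,\ldots,k_j,$$ with orientation determined by the sign $(-1)^{k_1+\cdots+k_{j-1}+i}$. That is, the codimension-one faces of $\Delta^{\overline{k}}$ are the faces $\delta_{j;i}(\Delta^{\overline{k}})$, each occurring in the oriented boundary with sign $(-1)^{k_1+\cdots+k_{j-1}+i}$, and the edge labeling of $\delta_{j;i}(\Delta^{\overline{k}})$ obtained by restricting the good labeling given by $\overline{g}$ is, under the canonical identification of $\delta_{j;i}(\Delta^{\overline{k}})$ with $\Delta^{\overline{k}-1_j}$, the good labeling determined by $d_{j;i}(\overline{g})$.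
   Context: A shalgebra $(G,\cdot,\triangleleft)$ is a set $G$ with two binary operations such that for all $a,b,c\in G$: $(ab)c=a(bc)$; $(ab)\triangleleft c=(a\triangleleft c)(b\triangleleft c)$; $(a\triangleleft b)\triangleleft c=a\triangleleft(bc)$; $(a\triangleleft b)\triangleleft c=(a\triangleleft c)\triangleleft(b\triangleleft c)$. Here $ab$ means $a\cdot b$. The vertices of the standard simplex $\Delta^m$ are numbered $0,1,\ldots,m$, which orders them and orients $\Delta^m$; $\Delta^{m;\hat{i}}$ denotes the face of $\Delta^m$ not containing the vertex $i$. Products of simplices carry the product orientation. Edges of $\Delta^m$ are directed $p\to p'$ with $p<p'$. Elements of $G^{\overline{k}}$ are written $\overline{g}=(g_1,\ldots,g_{k_1})|\cdots|(g_{s+1},\ldots,g_{s+k_j})|\cdots|(g_{t+1},\ldots,g_n)$, where the $j$th block begins after position $s=s_j:=k_1+\cdots+k_{j-1}$ and $t=s_\ell$. Good labeling: the edge $\{p_1\}\times\cdots\times\{p_{q-1}\}\times(p_q\to p'_q)\times\{p_{q+1}\}\times\cdots\times\{p_\ell\}$ of $\Delta^{\overline{k}}$, with $p_q<p'_q$, receives the label $$(g_{s_q+p_q+1}\cdots g_{s_q+p'_q})\triangleleft(g_{q+1;p_{q+1}}\cdots g_{\ell;p_\ell}),\qquad g_{u;p_u}:=g_{s_u+1}\cdots g_{s_u+p_u},$$ where empty products are omitted, and $\triangleleft$-action by an empty product is trivial. The partition $\overline{k}-1_j$ of $n-1$ is obtained from $\overline{k}$ by replacing $k_j$ with $k_j-1$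 if $k_j>1$, and by deleting the $j$th part if $k_j=1$. The maps $d_{j;i}\colon G^{\overline{k}}\to G^{\overline{k}-1_j}$, $0\le i\le k_j$, are defined as follows, with $s=s_j$: - $d_{j;0}$ replaces every entry $g_t$ with $t\le s$ by $g_t\triangleleft g_{s+1}$, and deletes the entry $g_{s+1}$ from the $j$th block; - for $0<i<k_j$, $d_{j;i}$ replaces the two consecutive entries $g_{s+i},g_{s+i+1}$ of the $j$th block by the single entry $g_{s+i}\cdot g_{s+i+1}$; - $d_{j;k_j}$ deletes the last entry $g_{s+k_j}$ of the $j$th block. All other entries are unchanged. If $k_j=1$, the block, which becomes empty, is removed. $\delta_{j;i}(\Delta^{\overline{k}}):=\Delta^{k_1}\times\cdots\times\Delta^{k_j;\hat{i}}\times\cdots\times\Delta^{k_\ell}$. It is identified with $\Delta^{\overline{k}-1_j}$ by the unique order-preserving renumbering of the vertices of $\Delta^{k_j;\hat{i}}$ by $0,\ldots,k_j-1$; if $k_j=1$ this one-point factor is dropped. For $n=1$ the faces are vertices, which carry no label. *)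

(* Defs.v *)
From HB Require Import structures.
From mathcomp Require Import all_boot all_order all_algebra.
From mathcomp Require Import boolp classical_sets reals.

Set Implicit Arguments.
Unset Strict Implicit.
Unset Printing Implicit Defensive.

Import Order.TTheory GRing.Theory Num.Theory.

Record shalgebra := Shalgebra {
  carrier :> Type;
  sh_mul : carrier -> carrier -> carrier;
  sh_act : carrier -> carrier -> carrier;
  sh_mulA : forall a b c, sh_mul (sh_mul a b) c = sh_mul a (sh_mul b c);
  sh_act_mull : forall a b c,
    sh_act (sh_mul a b) c = sh_mul (sh_act a c) (sh_act b c);
  sh_act_mulr : forall a b c, sh_act (sh_act a b) c = sh_act a (sh_mul b c);
  sh_act_act : forall a b c,
    sh_act (sh_act a b) c = sh_act (sh_act a c) (sh_act b c)
}.

(* An ordered partition is a k : seq nat with positive entries.  Parts are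
   numbered from 0, and nth 0 k j is the size of the part number j. *)

Definition remove1 (k : seq nat) (j : nat) : seq nat :=
  take j k ++ (if nth 0 k j <= 1 then [::] else [:: (nth 0 k j).-1])
           ++ drop j.+1 k.

Definition blocks (G : Type) (k : seq nat) : Type :=
  {gs : seq (seq G) | shape gs == k}.

Section FaceMaps.
Variable G : shalgebra.
Implicit Types (b : seq G) (gs : seq (seq G)).

(* The new j-th block.  In the second case i = i'.+1 and drop i' b starts with
   the (1-based) i-th entry of b, which is the last one exactly when i = k_j. *)
Definition face_block (i : nat) b : seq G :=
  match i with
  | 0 => behead b
  | i'.+1 => if drop i' b is x :: y :: b' then take i' b ++ sh_mul x y :: b'
             else take i' b
  end.

Definition face_prefix (i : nat) b gs : seq (seq G) :=
  if (i, b) is (0, x :: _) then [seq [seq sh_act y x | y <- c] | c <- gs]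
  else gs.

Definition face_seq (j i : nat) gs : seq (seq G) :=
  let b := nth [::] gs j in
  face_prefix i b (take j gs)
    ++ (if face_block i b is [::] then [::] else [:: face_block i b])
    ++ drop j.+1 gs.

Lemma shape_face_prefix i b gs : shape (face_prefix i b gs) = shape gs.
Proof.
rewrite /face_prefix; case: i b => [|i] [|x b] //=.
by rewrite /shape -map_comp; apply: eq_map => c /=; rewrite size_map.
Qed.

Lemma size_face_block i b : i <= size b ->
  size (face_block i b) = (size b).-1.
Proof.
case: i => [|i] /= ltib; first by rewrite size_behead.
have sD : size (drop i b) = (size b - i) by rewrite size_drop.
have sT : size (take i b) = i by rewrite size_takel // ltnW.
case: (drop i b) sD => [|x [|y b']] /= sD.
- by move/eqP: sD; rewrite eq_sym subn_eq0 leqNgt ltib.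
- by rewrite sT -[size b](subnK (ltnW ltib)) -sD.
- rewrite size_cat /= sT -[size b](subnK (ltnW ltib)) -sD.
  by rewrite addnC.
Qed.

Lemma shape_face_seq k (j : 'I_(size k)) (i : 'I_(nth 0 k j).+1) gs :
  shape gs == k -> shape (face_seq j i gs) == remove1 k j.
Proof.
move=> /eqP sg; apply/eqP.
have sj : size (nth [::] gs j) = nth 0 k j.
  have ltj : j < size gs by rewrite -(size_map size) -/(shape gs) sg.
  by rewrite -(nth_map [::] 0 size ltj) -/(shape gs) sg.
have lei : i <= size (nth [::] gs j) by rewrite sj -ltnS.
have := size_face_block lei.
rewrite /face_seq /remove1 /shape !map_cat -/(shape (face_prefix _ _ _)).
rewrite shape_face_prefix /shape map_take map_drop -/(shape gs) sg sj => e.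
congr (_ ++ (_ ++ _)); case: (face_block i _) e => [|x b'] /=.
  by case: (nth 0 k j) => [|[]].
by case: (nth 0 k j) => [|[|m]] //= [<-].
Qed.

Definition face_map k (j : 'I_(size k)) (i : 'I_(nth 0 k j).+1)
    (g : blocks G k) : blocks G (remove1 k j) :=
  exist _ (face_seq j i (val g)) (shape_face_seq i (valP g)).

End FaceMaps.

(* A vertex of the prism is the sequence of the numbers of its projections. *)
Definition is_vertex (k p : seq nat) : bool := all2 leq p k.

Definition is_edge (k p p' : seq nat) (q : nat) : Prop :=
  [/\ is_vertex k p, is_vertex k p', q < size k,
      nth 0 p q < nth 0 p' q &
      forall u, u != q -> nth 0 p' u = nth 0 p u].

Record edge (k : seq nat) := Edge {
  src : seq nat;
  tgt : seq nat;
  dir : nat;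
  edgeP : is_edge k src tgt dir
}.

Lemma is_vertexP k p : reflect
  (size p = size k /\ forall u, nth 0 p u <= nth 0 k u) (is_vertex k p).
Proof.
rewrite /is_vertex all2E; apply: (iffP andP) => [[/eqP spk /all_nthP le_pk]|].
  split=> // u; case: (ltnP u (size p)) => [ltu|geu]; last first.
    by rewrite nth_default.
  have := le_pk (0, 0) u; rewrite size_zip spk minnn -spk => /(_ ltu).
  by rewrite nth_zip.
move=> [spk le_pk]; split; first exact/eqP.
by apply/(all_nthP (0, 0)) => u _; rewrite nth_zip //= le_pk.
Qed.

Section Labeling.
Variable G : shalgebra.

Definition prod_ne (s : seq G) : 0 < size s -> G :=
  match s with
  | [::] => fun s_gt0 => False_rect G (notF s_gt0)
  | x :: s' => fun _ => foldl (@sh_mul G) x s'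
  end.

Definition act_prod (a : G) (s : seq G) : G :=
  if s is x :: s' then sh_act a (foldl (@sh_mul G) x s') else a.

Variables (k : seq nat) (g : blocks G k).

Definition label_base (e : edge k) : seq G :=
  take (nth 0 (tgt e) (dir e) - nth 0 (src e) (dir e))
    (drop (nth 0 (src e) (dir e)) (nth [::] (val g) (dir e))).

Definition label_exponent (e : edge k) : seq G :=
  flatten [seq take (nth 0 (src e) u) (nth [::] (val g) u)
          | u <- iota (dir e).+1 (size k - (dir e).+1)].

Lemma label_base_gt0 e : 0 < size (label_base e).
Proof.
case: e => p p' q epp'; rewrite /label_base /=.
have [_ /is_vertexP[_ /(_ q) le'] ltq lt_pp' _] := epp'.
rewrite size_take_min size_drop leq_min subn_gt0 lt_pp' subn_gt0.
suff -> : size (nth [::] (val g) q) = nth 0 k q by exact: leq_trans le'.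
have sg := eqP (valP g); rewrite -[in RHS]sg /shape (nth_map [::]) //.
by rewrite -(size_map size) -/(shape _) sg.
Qed.

Definition good_label (e : edge k) : G :=
  act_prod (prod_ne (label_base_gt0 e)) (label_exponent e).

End Labeling.

(* The vertices and edges of the smaller prism seen in the face of the bigger
   one: bump i is the increasing bijection from the natural numbers onto those
   different from i.  A one-element part j is absent from remove1 k j, so that
   a j-th coordinate must be inserted in this case. *)

Definition face_vertex (k : seq nat) (j i : nat) (p : seq nat) : seq nat :=
  if nth 0 k j <= 1 then take j p ++ bump i 0 :: drop j p
  else take j p ++ bump i (nth 0 p j) :: drop j.+1 p.

Definition face_dir (k : seq nat) (j q : nat) : nat :=
  if nth 0 k j <= 1 then bump j q else q.

Lemma face_vertexE k j i p u : is_vertex (remove1 k j) p -> j < size k ->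
  nth 0 (face_vertex k j i p) u =
  if u == j then bump i (if nth 0 k j <= 1 then 0 else nth 0 p j)
  else nth 0 p (if nth 0 k j <= 1 then unbump j u else u).
Proof.
move=> /is_vertexP[sp _] ltj.
have szp : size p = (if nth 0 k j <= 1 then (size k).-1 else size k).
  rewrite sp /remove1 !size_cat size_takel ?(ltnW ltj) // size_drop.
  by case: (_ <= 1) => /=;
     rewrite -[in RHS](subnKC ltj) /= ?add0n ?addSnnS ?add1n.
have lej : j <= size p.
  by rewrite szp; case: ifP => _; [rewrite -ltnS (ltn_predK ltj)|exact: ltnW].
rewrite /face_vertex.
case: ifP => _; rewrite nth_cat size_takel //.
  case: (ltngtP u j) => [ltuj|gtuj|->]; last by rewrite subnn.
  - by rewrite nth_take // /unbump ltnNge (ltnW ltuj) /= subn0.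
  - rewrite -[u in u - j](ltn_predK gtuj) subSn /=; last first.
      by rewrite -ltnS (ltn_predK gtuj).
    rewrite nth_drop subnKC; last by rewrite -ltnS (ltn_predK gtuj).
    by rewrite /unbump gtuj subn1.
case: (ltngtP u j) => [ltuj|gtuj|->]; last by rewrite subnn.
- by rewrite nth_take.
- rewrite -[u in u - j](ltn_predK gtuj) subSn /=; last first.
    by rewrite -ltnS (ltn_predK gtuj).
  by rewrite nth_drop addSn subnKC ?(ltn_predK gtuj) // -ltnS (ltn_predK gtuj).
Qed.

Lemma size_face_vertex k j i p : is_vertex (remove1 k j) p -> j < size k ->
  size (face_vertex k j i p) = size k.
Proof.
move=> /is_vertexP[sp _] ltj.
have szp : size p = (if nth 0 k j <= 1 then (size k).-1 else size k).
  rewrite sp /remove1 !size_cat size_takel ?(ltnW ltj) // size_drop.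
  by case: (_ <= 1) => /=;
     rewrite -[in RHS](subnKC ltj) /= ?add0n ?addSnnS ?add1n.
rewrite /face_vertex; move: szp; case: ifP => _ szp.
  have lej : j <= size p by rewrite szp -ltnS (ltn_predK ltj).
  rewrite size_cat /= size_takel // size_drop addnS subnKC // szp.
  exact: ltn_predK ltj.
rewrite size_cat /= size_takel ?szp 1?ltnW // size_drop szp.
by rewrite addnS -addSn subnKC.
Qed.

Lemma nth_remove1 k j u : j < size k ->
  nth 0 (remove1 k j) u =
  if nth 0 k j <= 1 then nth 0 k (bump j u)
  else if u == j then (nth 0 k j).-1 else nth 0 k u.
Proof.
move=> ltj; rewrite /remove1 nth_cat size_takel ?(ltnW ltj) //.
case: (nth 0 k j <= 1) => /=.
  rewrite /bump; case: (ltnP u j) => [ltuj|leju]; first by rewrite nth_take.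
  by rewrite nth_drop addSn subnKC.
case: (ltngtP u j) => [ltuj|gtuj|->]; last by rewrite subnn.
- by rewrite nth_take.
- rewrite -[u in u - j](ltn_predK gtuj) subSn /=; last first.
    by rewrite -ltnS (ltn_predK gtuj).
  by rewrite nth_drop addSn subnKC ?(ltn_predK gtuj) // -ltnS (ltn_predK gtuj).
Qed.

Lemma is_vertex_face k (j : 'I_(size k)) (i : 'I_(nth 0 k j).+1) p :
  0 < nth 0 k j ->
  is_vertex (remove1 k j) p -> is_vertex k (face_vertex k j i p).
Proof.
move=> kj_gt0 pP; apply/is_vertexP; split; first exact: size_face_vertex.
move=> u; rewrite face_vertexE //.
have [_ lep] := is_vertexP _ _ pP.
have bump_le x : x <= (nth 0 k j).-1 -> bump i x <= nth 0 k j.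
  move=> lex; rewrite /bump; case: (i <= x) => /=; rewrite ?add0n ?add1n.
    by rewrite -(prednK kj_gt0) ltnS.
  exact: leq_trans lex (leq_pred _).
case: eqP => [->|/eqP neuj].
  case: ifP => k1; apply: bump_le => //.
  by have := lep j; rewrite nth_remove1 // k1 eqxx.
have := lep (if nth 0 k j <= 1 then unbump j u else u).
by rewrite nth_remove1 //; case: ifP => _; rewrite ?unbumpKcond (negPf neuj).
Qed.

Lemma face_vertex_inj k (j : 'I_(size k)) (i : 'I_(nth 0 k j).+1) p p' :
  is_vertex (remove1 k j) p -> is_vertex (remove1 k j) p' ->
  face_vertex k j i p = face_vertex k j i p' -> p = p'.
Proof.
move=> pP p'P e.
have [sp _] := is_vertexP _ _ pP; have [sp' _] := is_vertexP _ _ p'P.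
apply: (@eq_from_nth _ 0) => [|u _]; first by rewrite sp sp'.
have := congr1 (nth 0 ^~ (if nth 0 k j <= 1 then bump j u else u)) e.
rewrite !face_vertexE //; case: (nth 0 k j <= 1).
  by rewrite eq_sym (negPf (neq_bump _ _)) bumpK.
by case: eqP => // ->; apply: (can_inj (bumpK i)).
Qed.

(* The vertices of the face are those with j-th coordinate different from i. *)
Lemma face_vertexP k (j : 'I_(size k)) (i : 'I_(nth 0 k j).+1) p :
  0 < nth 0 k j -> is_vertex k p ->
  (exists2 p', is_vertex (remove1 k j) p' & p = face_vertex k j i p')
    <-> nth 0 p j != i.
Proof.
move=> kj_gt0 pP; split=> [[p' p'P ->]|neji].
  by rewrite face_vertexE // eqxx eq_sym neq_bump.
have [sp lep] := is_vertexP _ _ pP.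
have ltjp : j < size p by rewrite sp.
pose p' := take j p ++ (if nth 0 k j <= 1 then [::]
  else [:: unbump i (nth 0 p j)]) ++ drop j.+1 p.
have p'E u : nth 0 p' u = if nth 0 k j <= 1 then nth 0 p (bump j u)
    else if u == j then unbump i (nth 0 p j) else nth 0 p u.
  rewrite /p' nth_cat size_takel ?(ltnW ltjp) //; case: (nth 0 k j <= 1) => /=.
    rewrite /bump; case: (ltnP u j) => [ltuj|leju]; first by rewrite nth_take.
    by rewrite nth_drop addSn subnKC.
  case: (ltngtP u j) => [ltuj|gtuj|->]; last by rewrite subnn.
    by rewrite nth_take.
  rewrite -[u in u - j](ltn_predK gtuj) subSn /=; last first.
    by rewrite -ltnS (ltn_predK gtuj).
  by rewrite nth_drop addSn subnKC ?(ltn_predK gtuj) // -ltnS (ltn_predK gtuj).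
have unb : unbump i (nth 0 p j) <= (nth 0 k j).-1.
  have lei : i <= nth 0 k j by rewrite -ltnS.
  rewrite /unbump; case: (ltnP i (nth 0 p j)) => [_|ge] /=.
    by rewrite -!subn1 leq_sub2r.
  rewrite subn0 -ltnS (prednK kj_gt0); apply: leq_trans lei.
  by rewrite ltn_neqAle neji.
have p'P : is_vertex (remove1 k j) p'.
  apply/is_vertexP; split=> [|u].
    rewrite /p' /remove1 !size_cat.
    rewrite !size_takel ?(ltnW ltjp) ?(ltnW (ltn_ord j)) //.
    by rewrite !size_drop sp; case: ifP.
  by rewrite nth_remove1 // p'E; case: ifP => // _; case: eqP.
exists p' => //; apply: (@eq_from_nth _ 0) => [|u _].
  by rewrite sp size_face_vertex.
rewrite face_vertexE // !p'E eqxx; case: eqP => [->|/eqP neuj].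
  case: (leqP (nth 0 k j) 1) => kj; last by rewrite unbumpKcond (negPf neji).
  have := leq_trans (lep j) kj.
  have : i <= 1 by rewrite (leq_trans _ kj) // -ltnS.
  by rewrite /bump; case: (nth 0 p j) neji => [|[]]; case: (i : nat) => [|[]].
by case: (nth 0 k j <= 1); rewrite ?unbumpKcond (negPf neuj).
Qed.

Lemma face_edgeP k (j : 'I_(size k)) (i : 'I_(nth 0 k j).+1)
    (kj_gt0 : 0 < nth 0 k j) (e : edge (remove1 k j)) :
  is_edge k (face_vertex k j i (src e)) (face_vertex k j i (tgt e))
    (face_dir k j (dir e)).
Proof.
case: e => p p' q [pP p'P ltq ltpp' e] /=.
have ltq' : face_dir k j q < size k.
  have := ltq; rewrite /remove1 /face_dir !size_cat.
  rewrite size_takel ?(ltnW (ltn_ord j)) //.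
  rewrite size_drop; case: ifP => _ /=; rewrite ?add0n => lt.
    rewrite /bump; case: (j <= q); last first.
      by rewrite add0n (leq_trans lt) // -[X in _ <= X](subnKC (ltn_ord j))
                 leq_add2r.
    by rewrite add1n -[X in _ < X](subnKC (ltn_ord j)) addSn ltnS.
  by move: lt; rewrite add1n addnS -addSn subnKC.
split=> //; try exact: is_vertex_face.
  rewrite !face_vertexE // /face_dir; case: (nth 0 k j <= 1).
    by rewrite eq_sym (negPf (neq_bump _ _)) bumpK.
  case: eqP ltpp' => [-> ltpp'|//]; rewrite /bump -addnS leq_add //.
  by case: (leqP i (nth 0 p j)) => // le; rewrite (leq_trans le) // ltnW.
move=> u neu; rewrite !face_vertexE //; case: eqP => [eu|/eqP nej].
  congr (bump _ _); case: ifP => // k1.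
  by rewrite e // -eu; move: neu; rewrite /face_dir k1.
rewrite e //; move: neu; rewrite /face_dir; case: ifP => // _.
by apply: contraNneq => <-; rewrite unbumpKcond (negPf nej).
Qed.

Definition face_edge k (j : 'I_(size k)) (i : 'I_(nth 0 k j).+1)
    (kj_gt0 : 0 < nth 0 k j) (e : edge (remove1 k j)) : edge k :=
  Edge (face_edgeP i kj_gt0 e).

Section Geometry.
Local Open Scope ring_scope.
Local Open Scope classical_set_scope.
Variable R : realType.

Section Convex.
Variable V : vectType R.
Implicit Types (P F : set V) (A B : seq V) (U : {vspace V}).

(* The linear subspace parallel to the affine hull of P. *)
Definition is_direction P U : Prop :=
  (forall x y, P x -> P y -> x - y \in U) /\
  (forall U', (forall x y, P x -> P y -> x - y \in U') -> (U <= U')%VS).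

Definition has_dim P (d : nat) : Prop :=
  exists2 U, is_direction P U & \dim U = d.

Definition is_face P F : Prop :=
  F !=set0 /\
  exists phi : {linear V -> R^o},
    F = [set x | P x /\ forall y, P y -> phi y <= phi x].

Definition is_codim1_face P F : Prop :=
  is_face P F /\ exists2 d, has_dim P d.+1 & has_dim F d.

(* The orientations of P are given by ordered bases of its direction. *)
Definition is_frame P A : Prop :=
  exists2 U, is_direction P U & basis_of U A.

Definition relative_orientation A B (s : R) : Prop :=
  size B = size A /\
  exists2 M : 'M[R]_(size A),
    (forall r : 'I_(size A), B`_r = \sum_(c < size A) M r c *: A`_c) &
    Num.sg (\det M) = s.

(* The oriented set (F, B) occurs with sign s in the boundary of (P, A), for
   the convention "outward vector first".  When F is a facet of the polytope P,
   the vectors x - y below point outwards. *)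
Definition boundary_sign P A F B (s : R) : Prop :=
  [/\ is_frame P A, is_frame F B &
      forall x y, F x -> P y -> ~ F y ->
        relative_orientation A (x - y :: B) s].

End Convex.

Section Prism.
Variable k : seq nat.

(* The prism lies in the product of the spaces R^(k_j + 1); a coordinate is a
   pair of a part j and a vertex i of Delta^(k_j). *)
Definition prism_coord : finType := {u : 'I_(size k) & 'I_(nth 0%N k u).+1}.

Definition prism_space : vectType R := {ffun prism_coord -> R^o}.

Definition std_simplex (m : nat) : set ('I_m.+1 -> R) :=
  [set y | (forall a, 0 <= y a) /\ \sum_a y a = 1].

Definition prism : set prism_space :=
  [set x : {ffun prism_coord -> R^o} | forall u : 'I_(size k),
    std_simplex (fun a => x (existT _ u a))].

Definition prism_face (j : 'I_(size k)) (i : 'I_(nth 0%N k j).+1) :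
    set prism_space :=
  [set x : {ffun prism_coord -> R^o} | prism x /\ x (existT _ j i) = 0].

Definition vertex_point (p : seq nat) : prism_space :=
  [ffun c : prism_coord => (tagged c == nth 0%N p (tag c) :> nat)%:R : R^o].

End Prism.

(* Given the positions f of the vertices of a prism Delta^k, the product
   orientation: each factor Delta^m has the frame v_1 - v_0, ..., v_m - v_0. *)
Definition product_frame (V : vectType R) (k : seq nat) (f : seq nat -> V) :
    seq V :=
  [seq f (set_nth 0%N (nseq (size k) 0%N) u a) - f (nseq (size k) 0%N)
  | u <- iota 0%N (size k), a <- iota 1%N (nth 0%N k u)].

Definition prism_frame (k : seq nat) : seq (prism_space k) :=
  product_frame k (vertex_point k).

(* The orientation of the face as a copy of the prism of remove1 k j. *)
Definition face_frame (k : seq nat) (j : 'I_(size k))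
    (i : 'I_(nth 0%N k j).+1) : seq (prism_space k) :=
  product_frame (remove1 k j) (fun p => vertex_point k (face_vertex k j i p)).

End Geometry.

Arguments prism : clear implicits.
Arguments prism_face R {k j} i.
Arguments prism_frame : clear implicits.
Arguments face_frame R {k j} i.

(* Main.v *)
From HB Require Import structures.
Require Import Defs.
From mathcomp Require Import all_boot all_order all_algebra.
From mathcomp Require Import boolp classical_sets reals.

Set Implicit Arguments.
Unset Strict Implicit.
Unset Printing Implicit Defensive.

Import Order.TTheory GRing.Theory Num.Theory.

(** Three independent facts make up the theorem.

    Labels.  By (a <| b) <| c = a <| (b c), acting by a product is acting by
    its factors in turn, so every label is a product of entries of one block
    acted on successively by prefixes of the later blocks.  The inner and the
    last face maps replace two adjacent entries by their product or forget an
    entry that no label sees, and neither changes such an expression, by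
    associativity or by the same law.  For d_{j;0}, a prefix of the j-th block
    in the big prism begins with the additional entry h = g_{s+1}; the two
    distributivity laws move the action of h past the entries that stand before
    it, and this is the action of h on the earlier blocks that d_{j;0} performs
    (good_label_face).

    Facets.  A linear form phi on the prism is maximal exactly at the points
    supported by the coordinates c at which phi (unit_vec c) is maximal in its
    block (argmax_sub_prism); so every face is the part of the prism supported
    by some set S of coordinates.  Any such part has an explicit frame made of
    the vectors unit_vec c - unit_vec b_u, for c in part u, where b is a vertex
    of the face and b_u its coordinate in part u (sub_prism_frame).  In
    codimension one S omits some coordinate c0, and the direction of the face
    is then that of the facet where the entry at c0 is 0; S omits only c0,
    since a vertex b of the face and any other omitted coordinate c would give
    a vector unit_vec c - unit_vec b_u in this direction (codim1_faceP).

    Signs.  The coordinates of a vector in the frame of the prism are its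
    entries at the pairs (u, a) with a > 0.  The frame of the facet (j, i) is
    indexed by these pairs in the same order, except that one pair, (j, i) or
    (j, 1) when i = 0, is missing; its position is t = k_1 + ... + k_(j-1) +
    max(i, 1) - 1 (face_pairs).  So the matrix that puts the outward vector z
    in front of the facet frame becomes the identity when the row of z and
    column t are deleted.  The entry at (j, i) is a linear form that vanishes
    on the facet frame, is negative at z, and is 1 (or -1 when i = 0) at the
    t-th frame vector of the prism; Cramer's rule gives the sign of the
    determinant from these data (det_minor1, orientation_face). *)

(** * Labels *)

Section Labels.
Variable G : shalgebra.
Implicit Types (a h x y : G) (s t b : seq G) (gs : seq (seq G)).

Lemma act_foldl_mul a x s :
  sh_act a (foldl (@sh_mul G) x s) = foldl (@sh_act G) (sh_act a x) s.
Proof.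
by elim: s x a => //= y s IHs x a; rewrite IHs sh_act_mulr.
Qed.

(** This form of the action makes concatenation of exponents easy, and needs no
    case distinction for the empty product. *)
Lemma act_prodE a s : act_prod a s = foldl (@sh_act G) a s.
Proof. by case: s => //= x s; rewrite act_foldl_mul. Qed.

Lemma prod_ne_irr s t (s_gt0 : 0 < size s) (t_gt0 : 0 < size t) :
  s = t -> prod_ne s_gt0 = prod_ne t_gt0.
Proof. by move=> est; subst t; rewrite (bool_irrelevance s_gt0 t_gt0). Qed.

(** The equality case covers the face maps that leave the relevant entries
    intact, so that one relation serves for all positions of an edge. *)
Definition merges s t : Prop :=
  s = t \/ exists u x y v, s = u ++ x :: y :: v /\ t = u ++ sh_mul x y :: v.

Lemma merge_prod_ne s t (s_gt0 : 0 < size s) (t_gt0 : 0 < size t) :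
  merges s t -> prod_ne s_gt0 = prod_ne t_gt0.
Proof.
case=> [|[u [x [y [v [es et]]]]]]; first exact: prod_ne_irr.
subst s t; case: u s_gt0 t_gt0 => [|z u] //= _ _.
by rewrite !foldl_cat /= sh_mulA.
Qed.

Lemma merge_foldl_act a s t :
  merges s t -> foldl (@sh_act G) a s = foldl (@sh_act G) a t.
Proof.
case=> [-> //|[u [x [y [v [-> ->]]]]]].
by rewrite !foldl_cat /= sh_act_mulr.
Qed.

Lemma prod_ne_map h s (s_gt0 : 0 < size s)
    (t_gt0 : 0 < size [seq sh_act y h | y <- s]) :
  prod_ne t_gt0 = sh_act (prod_ne s_gt0) h.
Proof.
case: s s_gt0 t_gt0 => //= x s _ _.
by elim: s x => //= y s IHs x; rewrite -sh_act_mull.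
Qed.

(** The action by h is an endomorphism of the action, which is how h gets past
    the exponents that precede it. *)
Lemma foldl_act_map a h s :
  foldl (@sh_act G) (sh_act a h) [seq sh_act y h | y <- s]
  = sh_act (foldl (@sh_act G) a s) h.
Proof. by elim: s a => //= x s IHs a; rewrite -sh_act_act. Qed.

(** The entries between the vertices bump i p and bump i p' of the big simplex
    against those between p and p' of its i-th face: a merged pair occurs when
    the edge passes over the vertex i, and nothing changes otherwise. *)
Lemma merge_segment i b p p' : i <= size b -> p <= p' -> p' < size b ->
  merges (take (bump i p' - bump i p) (drop (bump i p) b))
        (take (p' - p) (drop p (face_block i b))).
Proof.
case: i => [|i] leib lepp' ltp'b.
  by left; rewrite /bump !add1n subSS /= -addn1 -drop_drop drop1.
rewrite /bump /=; have : size (drop i b) = size b - i by rewrite size_drop.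
have eb : b = take i b ++ drop i b by rewrite cat_take_drop.
have st : size (take i b) = i by rewrite size_takel // ltnW.
case ed: (drop i b) => [|x [|y v]] /= sd.
- by move: leib; rewrite -subn_gt0 -sd.
- have ib : size b = i.+1 by rewrite -(subnK leib) subnS -sd.
  have lt c : c <= p' -> (i < c) = false.
    by move=> le; apply/negbTE; rewrite -leqNgt (leq_trans le) // -ltnS -ib.
  left; rewrite !lt // !add0n eb ed take_cat st ltnn subnn take0 cats0.
  rewrite drop_cat st; case: (ltnP p i) => [ltpi|leip].
    rewrite takel_cat // size_drop st leq_sub2r // -ltnS -ib //.
  have -> : p = p'.
    by apply/eqP; rewrite eqn_leq lepp' (leq_trans _ leip) // -ltnS -ib.
  by rewrite subnn !take0.
- move: eb st; rewrite ed; set u := take i b => eb st; rewrite eb.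
  case: (ltnP i p') => [ltip'|lep'i]; last first.
    have -> : (i < p) = false by rewrite ltnNge (leq_trans lepp').
    left; rewrite !add0n !drop_cat st; case: ltnP => [ltpi|leip].
      by rewrite !takel_cat // size_drop st leq_sub2r.
    have -> : p = p' by apply/eqP; rewrite eqn_leq lepp' (leq_trans lep'i).
    by rewrite subnn !take0.
  case: (ltnP i p) => [ltip|lepi].
    left; rewrite !add1n subSS !drop_cat st.
    rewrite !ltnNge (ltnW ltip) (leqW (ltnW ltip)) /= subSn ?(ltnW ltip) //=.
    by rewrite -(subnSK ltip) /=.
  right; exists (drop p u), x, y, (take (p' - i.+1) v).
  have su : size (drop p u) = i - p by rewrite size_drop st.
  have e z : drop p (u ++ z) = drop p u ++ z.
    rewrite drop_cat st; case: ltnP => // leip.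
    have -> : p = i by apply/eqP; rewrite eqn_leq lepi.
    by rewrite subnn drop0 drop_oversize ?st.
  rewrite add0n !e add1n !take_cat su !ltnNge.
  rewrite (leq_sub2r p (ltnW ltip')) leq_sub2r 1?ltnW ?ltnS 1?ltnW //=.
  rewrite -!subnDA !subnKC //.
  by rewrite subSn ?(ltnW ltip') // -(subnSK ltip').
Qed.

(** This fails for i = 0, where the prefix in the big simplex has the
    additional first entry of b. *)
Lemma merge_prefix i b p : 0 < i <= size b -> p < size b ->
  merges (take (bump i p) b) (take p (face_block i b)).
Proof.
case: i => // i leib ltpb.
have := @merge_segment i.+1 b 0 p leib (leq0n _) ltpb.
by rewrite /bump /= !add0n !subn0 !drop0.
Qed.

(** The products g_{u;p_u}, one for each block u, as sequences of factors. *)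
Definition prefixes (p : seq nat) gs : seq (seq G) :=
  [seq take c.1 c.2 | c <- zip p gs].

Lemma prefixes_cat p1 p2 gs1 gs2 : size p1 = size gs1 ->
  prefixes (p1 ++ p2) (gs1 ++ gs2) = prefixes p1 gs1 ++ prefixes p2 gs2.
Proof. by move=> s1; rewrite /prefixes zip_cat // map_cat. Qed.

Lemma size_prefixes p gs : size p = size gs -> size (prefixes p gs) = size gs.
Proof. by move=> s; rewrite size_map size_zip s minnn. Qed.

Lemma prefixes_map h p gs :
  prefixes p [seq [seq sh_act y h | y <- c] | c <- gs]
  = [seq [seq sh_act y h | y <- c] | c <- prefixes p gs].
Proof.
rewrite /prefixes; elim: gs p => [|c gs IHgs] [|m p] //=.
by rewrite IHgs map_take.
Qed.

Lemma size_blocks k (g : blocks G k) : size (val g) = size k.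
Proof. by have /eqP/(congr1 size) := valP g; rewrite size_map. Qed.

Lemma label_exponentE k (g : blocks G k) (e : edge k) :
  label_exponent g e = flatten (drop (dir e).+1 (prefixes (src e) (val g))).
Proof.
have [/is_vertexP[sp _] _ ltq _ _] := edgeP e; rewrite /label_exponent.
move: (src e) (dir e) sp ltq => p q sp ltq.
have sg := size_blocks g.
have spg : size (prefixes p (val g)) = size k by rewrite size_prefixes ?sp sg.
congr flatten; apply: (@eq_from_nth _ [::]) => [|u].
  by rewrite size_map size_iota size_drop spg.
rewrite size_map size_iota => ltu.
have ltu' : q.+1 + u < size k by rewrite -ltn_subRL.
rewrite (nth_map 0) ?size_iota // nth_iota // nth_drop /prefixes.
by rewrite (nth_map (0, [::])) ?size_zip ?sp ?sg ?minnn // nth_zip ?sp ?sg.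
Qed.

Lemma flatten_map_act h (ss : seq (seq G)) :
  flatten [seq [seq sh_act y h | y <- c] | c <- ss]
  = [seq sh_act y h | y <- flatten ss].
Proof. by rewrite map_flatten. Qed.

Section Face.
Variables (k : seq nat) (j : 'I_(size k)) (i : 'I_(nth 0 k j).+1).
Hypothesis kj_gt0 : 0 < nth 0 k j.
Variables (g : blocks G k) (e : edge (remove1 k j)).

Let b := nth [::] (val g) j.

Lemma size_nth_block : size b = nth 0 k j.
Proof.
have /eqP/(congr1 (nth 0 ^~ (j : nat))) := valP g.
by rewrite /= (nth_map [::]) ?size_blocks.
Qed.

Lemma nth_face_seq u :
  nth [::] (face_seq j i (val g)) u =
  let v := face_dir k j u in
  if v < j then nth [::] (face_prefix i b (take j (val g))) v
  else if v == j then face_block i b else nth [::] (val g) v.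
Proof.
have sg := size_blocks g.
have ltj : j < size (val g) by rewrite sg.
have sP : size (face_prefix i b (take j (val g))) = j.
  rewrite -(size_map size) -/(shape _) shape_face_prefix size_map.
  by rewrite size_takel // ltnW.
have sb : size (face_block i b) = (nth 0 k j).-1.
  by rewrite size_face_block size_nth_block // -ltnS.
rewrite /face_seq -/b /face_dir nth_cat sP /=.
case: (leqP (nth 0 k j) 1) => kj1.
  have -> : face_block i b = [::].
    by apply/nilP; rewrite /nilp sb -subn1 subn_eq0.
  rewrite /bump /=; case: (ltnP u j) => [ltuj|leju].
    by rewrite add0n ltuj.
  rewrite add1n ltnNge leqW //= gtn_eqF ?ltnS //.
  by rewrite nth_drop addSn subnKC.
case eb : (face_block i b) sb => [|x s] /=.
  by move/esym/eqP; rewrite -subn1 subn_eq0 leqNgt kj1.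
move=> _; case: (ltngtP u j) => [//|gtuj|->]; last by rewrite subnn.
by rewrite -(subnSK gtuj) /= nth_drop subnKC.
Qed.

(* A one-element part j is absent from the small prism; pj and p2 make the two
   cases look alike, with the vertex 0 of a point in place of part j. *)
Let pj (p : seq nat) := if nth 0 k j <= 1 then 0 else nth 0 p j.
Let p2 (p : seq nat) := drop (if nth 0 k j <= 1 then j : nat else j.+1) p.

Lemma prefixes_face_vertex p : is_vertex (remove1 k j) p ->
  prefixes (face_vertex k j i p) (val g)
  = prefixes (take j p) (take j (val g))
      ++ take (bump i (pj p)) b :: prefixes (p2 p) (drop j.+1 (val g)).
Proof.
move=> pP; have sg := size_blocks g.
have ltj : j < size (val g) by rewrite sg.
have lej : j <= size p.
  have [-> _] := is_vertexP _ _ pP.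
  by rewrite /remove1 size_cat size_takel ?leq_addr // ltnW.
rewrite -{1}(cat_take_drop j (val g)) (drop_nth [::]) // -/b.
rewrite /face_vertex /pj /p2; case: ifP => _;
  by rewrite prefixes_cat // !size_takel // ltnW.
Qed.

Lemma prefixes_face_seq p : is_vertex (remove1 k j) p ->
  prefixes p (face_seq j i (val g))
  = prefixes (take j p) (face_prefix i b (take j (val g)))
      ++ (if nth 0 k j <= 1 then [::] else [:: take (pj p) (face_block i b)])
      ++ prefixes (p2 p) (drop j.+1 (val g)).
Proof.
move=> pP; have sg := size_blocks g.
have [sp _] := is_vertexP _ _ pP.
have lej : j <= size p.
  by rewrite sp /remove1 size_cat size_takel ?leq_addr // ltnW.
have sP : size (face_prefix i b (take j (val g))) = j.
  rewrite -(size_map size) -/(shape _) shape_face_prefix size_map.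
  by rewrite size_takel // sg ltnW.
have sb : size (face_block i b) = (nth 0 k j).-1.
  by rewrite size_face_block size_nth_block // -ltnS.
rewrite /face_seq -/b /pj /p2 -{1}(cat_take_drop j p).
rewrite prefixes_cat ?size_takel ?sP //; congr (_ ++ _).
case: (leqP (nth 0 k j) 1) => kj1.
  suff -> : face_block i b = [::] by [].
  by apply/nilP; rewrite /nilp sb -subn1 subn_eq0.
have ltjp : j < size p.
  rewrite sp /remove1 (ltn_geF kj1) !size_cat size_takel ?(ltnW (ltn_ord j)) //.
  by rewrite /= addnS ltnS leq_addr.
rewrite (drop_nth 0) //; case eb : (face_block i b) sb => [|c s] //=.
by move/esym/eqP; rewrite -subn1 subn_eq0 leqNgt kj1.
Qed.

(** The edge lies in direction q' in the big prism.  When q' > j neither the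
    base nor the exponent meets the j-th block; when q' = j only the base does;
    when q' < j only the exponent does, and i = 0 is the case that uses the
    compatibility of the action with both operations. *)
Lemma good_label_face :
  good_label g (face_edge i kj_gt0 e) = good_label (face_map i g) e.
Proof.
have sg := size_blocks g.
have ltj : j < size (val g) by rewrite sg.
have sb := size_nth_block.
have lei : i <= size b by rewrite sb -ltnS.
have s1 : size (take j (val g)) = j by rewrite size_takel // ltnW.
have sP : size (face_prefix i b (take j (val g))) = j.
  by rewrite -(size_map size) -/(shape _) shape_face_prefix size_map.
rewrite /good_label !act_prodE !label_exponentE.
move: (label_base_gt0 g _) (label_base_gt0 (face_map i g) _).
rewrite /label_base /=.
have [pP p'P ltq lepp' epp'] := edgeP e.
have [_ _ ltq' _ _] := face_edgeP i kj_gt0 e.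
set p := src e in pP lepp' epp' *; set p' := tgt e in p'P lepp' epp' *.
set q := dir e in ltq ltq' lepp' epp' *; clearbody p p' q.
rewrite prefixes_face_vertex // prefixes_face_seq // nth_face_seq /=.
rewrite !face_vertexE //.
set q' := face_dir k j q in ltq' *.
have eqq : q' != j -> (if nth 0 k j <= 1 then unbump j q' else q') = q.
  by rewrite /q' /face_dir; case: ifP => _; rewrite ?bumpK.
have ltpj c : is_vertex (remove1 k j) c -> pj c < size b.
  move=> /is_vertexP[_ lec]; rewrite sb -(prednK kj_gt0) ltnS /pj.
  by have := lec j; rewrite nth_remove1 // eqxx; case: ifP.
have sX : size (prefixes (take j p) (take j (val g))) = j.
  rewrite size_prefixes ?s1 // size_takel //.
  have [-> _] := is_vertexP _ _ pP.
  by rewrite /remove1 size_cat size_takel ?leq_addr // ltnW.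
have sX' : size (prefixes (take j p) (face_prefix i b (take j (val g)))) = j.
  rewrite size_prefixes ?sP // size_takel //.
  have [-> _] := is_vertexP _ _ pP.
  by rewrite /remove1 size_cat size_takel ?leq_addr // ltnW.
case: (ltngtP q' j) => [ltq'j|gtq'j|eq'j].
- have neq'j : q' != j by rewrite ltn_eqF.
  have eq_q : q = q'.
    move: ltq'j; rewrite /q' /face_dir; case: ifP => // _; rewrite /bump.
    by case: (leqP j q) => // leqj; rewrite add1n ltnNge leqW.
  rewrite eqq // -eq_q => H1 H2.
  have ltqj : q.+1 <= j by rewrite eq_q.
  have dropE (A B : seq (seq G)) : size A = j ->
      flatten (drop q.+1 (A ++ B)) = flatten (drop q.+1 A) ++ flatten B.
    move=> sA; rewrite drop_cat sA; case: ltnP => [_|le].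
      by rewrite flatten_cat.
    have -> : q.+1 = j by apply/eqP; rewrite eqn_leq ltqj.
    by rewrite subnn drop0 drop_oversize ?sA.
  rewrite !dropE // !flatten_cat /=.
  set X2 := flatten (prefixes (p2 p) _).
  have -> : flatten (if nth 0 k j <= 1 then [::]
      else [:: take (pj p) (face_block i b)]) = take (pj p) (face_block i b).
    by rewrite /pj; case: (nth 0 k j <= 1); rewrite /= ?take0 ?cats0.
  rewrite !foldl_cat; congr foldl.
  (* Only the exponent from the j-th block and, for i = 0, the earlier blocks
     remain to be compared. *)
  have [i0|i_gt0] := posnP i; last first.
    have fP gs : face_prefix i b gs = gs.
      by rewrite /face_prefix; case: (i : nat) i_gt0.
    move: H2; rewrite fP nth_take // => H2; rewrite (bool_irrelevance H2 H1).
    by apply: merge_foldl_act; apply: merge_prefix; rewrite ?i_gt0 ?ltpj.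
  move: H2; rewrite i0; case: b sb (ltpj _ pP) => [|h b'] //= _ _.
  rewrite (nth_map [::]) ?s1 // nth_take // -map_drop -map_take => H2.
  rewrite prefixes_map -map_drop flatten_map_act add0n.
  by rewrite (prod_ne_map H1 H2) foldl_act_map.
- rewrite eqq ?gtn_eqF // => H1 H2; rewrite (bool_irrelevance H1 H2).
  congr (foldl _ _ (flatten _)).
  rewrite !drop_cat sX sX' ltnNge (leq_trans (ltnW gtq'j)) //=.
  have leqj : j <= q.
    move: gtq'j; rewrite /q' /face_dir; case: ifP => _; last exact: ltnW.
    by rewrite /bump; case: (leqP j q) => //= ltqj; rewrite add0n ltnNge ltnW.
  rewrite ltnNge (leq_trans leqj) //=.
  rewrite subSn ?(ltnW gtq'j) //=.
  move: leqj; rewrite /q' /face_dir; case: ifP => _ leqj /=.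
    by rewrite /bump leqj add1n subn0.
  by rewrite subSn // ltnS ltn0 subSS subn0.
- have [kj1 eqj] : ((nth 0 k j <= 1) = false) * (q = j).
    move: eq'j; rewrite /q' /face_dir; case: leqP => // _ /eqP.
    by rewrite eq_sym (negPf (neq_bump _ _)).
  rewrite eq'j kj1 -/b eqj => H1 H2.
  rewrite !drop_cat sX sX' ltnNge leqnSn /= subSnn /=.
  congr foldl.
  apply: merge_prod_ne; apply: merge_segment => //.
    by rewrite -eqj ltnW.
  by have := ltpj _ p'P; rewrite /pj kj1.
Qed.

End Face.

End Labels.

(** * The order of the frame vectors of a prism and of its facets *)

Section Delete.
Variable T : eqType.
Implicit Types (s : seq T) (t : nat).

Definition delete t s := take t s ++ drop t.+1 s.

Lemma nth_delete x0 t s a : t < size s ->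
  nth x0 (delete t s) a = nth x0 s (bump t a).
Proof.
move=> ltt; rewrite /delete nth_cat size_takel ?(ltnW ltt) // /bump.
by case: ltnP => [lta|leta]; rewrite ?nth_take ?nth_drop ?addSn ?subnKC.
Qed.

Lemma size_delete t s : t < size s -> size (delete t s) = (size s).-1.
Proof.
move=> ltt; rewrite /delete size_cat size_takel ?(ltnW ltt) // size_drop.
by rewrite -[in RHS](subnKC ltt).
Qed.

Lemma delete_uniq t s : uniq s -> uniq (delete t s).
Proof.
apply: subseq_uniq; rewrite -{2}(cat_take_drop t s) cat_subseq //.
by rewrite -add1n -drop_drop drop_subseq.
Qed.

Lemma mem_delete x0 t s x : t < size s -> uniq s ->
  (x \in delete t s) = (x \in s) && (x != nth x0 s t).
Proof.
move=> ltt Us; rewrite -{2}(cat_take_drop t s) (drop_nth x0 ltt) /delete.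
move: Us; rewrite -{1}(cat_take_drop t s) (drop_nth x0 ltt).
rewrite cat_uniq /= negb_or => /and3P[_ /andP[nt _] /andP[nd _]].
rewrite !mem_cat inE; case: eqP => [->|_] /=; last by rewrite andbT.
by rewrite (negPf nt) (negPf nd) andbF.
Qed.

End Delete.

Lemma map_delete (T T' : eqType) (f : T -> T') t s :
  [seq f x | x <- delete t s] = delete t [seq f x | x <- s].
Proof. by rewrite /delete map_cat map_take map_drop. Qed.

(** The pairs (part, nonzero vertex) that index the vectors of a product frame,
    in the order of the frame. *)
Definition pairs (k : seq nat) : seq (nat * nat) :=
  [seq (u, a) | u <- iota 0 (size k), a <- iota 1 (nth 0 k u)].

Lemma mem_pairs k u a : ((u, a) \in pairs k) = (0 < a <= nth 0 k u).
Proof.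
apply/allpairsPdep/idP => [[v [b [_]]]|lea].
  by rewrite mem_iota add1n ltnS => leb [-> ->].
exists u, a; rewrite !mem_iota add1n ltnS leq0n add0n; split=> //=.
rewrite ltnNge; apply/negP => le; move: lea; rewrite nth_default //.
by rewrite leqn0 andbC => /andP[/eqP->].
Qed.

Lemma pairs_uniq k : uniq (pairs k).
Proof.
apply: allpairs_uniq_dep => [|u _|]; rewrite ?iota_uniq //.
by move=> [u a] [v b] /= _ _ [-> ->].
Qed.

Lemma pairs_cons x k : pairs (x :: k) =
  [seq (0, a) | a <- iota 1 x] ++ [seq (p.1.+1, p.2) | p <- pairs k].
Proof.
rewrite /pairs map_allpairs /=; congr (_ ++ _).
by rewrite -(addn0 1) iotaDl addn0 (allpairs_mapl _ (addn 1)).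
Qed.

Lemma pairs_cat k1 k2 : pairs (k1 ++ k2) =
  pairs k1 ++ [seq (size k1 + p.1, p.2) | p <- pairs k2].
Proof.
elim: k1 => [|x k1 IHk1] /=.
  by rewrite -[LHS]map_id; apply: eq_map => -[].
rewrite !pairs_cons IHk1 map_cat catA -map_comp; congr (_ ++ _).
Qed.

Lemma size_pairs k : size (pairs k) = sumn k.
Proof.
by elim: k => //= x k IHk; rewrite pairs_cons size_cat !size_map size_iota IHk.
Qed.

Lemma delete_cat (T : eqType) t (s1 s2 : seq T) :
  delete (size s1 + t) (s1 ++ s2) = s1 ++ delete t s2.
Proof.
rewrite /delete -addnS take_cat drop_cat !ltnNge !leq_addr /= !addKn.
by rewrite catA.
Qed.

Lemma delete_catl (T : eqType) t (s1 s2 : seq T) : t < size s1 ->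
  delete t (s1 ++ s2) = delete t s1 ++ s2.
Proof.
move=> ltt; rewrite /delete -catA takel_cat ?(ltnW ltt) // drop_cat.
case: ltnP => // le; have -> : t.+1 = size s1 by apply/eqP; rewrite eqn_leq ltt.
by rewrite subnn drop0 drop_size.
Qed.

(** The increasing enumeration of the integers between 1 and x other than m. *)
Lemma delete_iota m x : 0 < m <= x ->
  delete m.-1 (iota 1 x) = [seq bump m a | a <- iota 1 x.-1].
Proof.
case: m => [//|m] /= ltmx; apply: (@eq_from_nth _ 0).
  by rewrite size_delete ?size_map !size_iota.
rewrite size_delete ?size_iota // => a lta.
rewrite nth_delete ?size_iota // (nth_map 0) ?size_iota //.
rewrite !nth_iota //; last first.
  rewrite /bump; case: (leqP m a) => _ /=; last first.
    by rewrite add0n (leq_trans lta) ?leq_pred.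
  by rewrite add1n -(ltn_predK ltmx) ltnS.
by rewrite /bump ltnS addnCA.
Qed.

(** The place in the big prism of a pair of its facet.  The vector of the facet
    frame with index p has entry 1 there, and 0 at the other such places. *)
Definition face_pair (k : seq nat) (j i : nat) (p : nat * nat) : nat * nat :=
  let u := face_dir k j p.1 in (u, if u == j then bump i p.2 else p.2).

(** The missing pair is (j, max(i, 1)).  The nonzero vertices of the j-th
    simplex other than i index the facet frame when i > 0; when i = 0 its
    origin is the vertex 1, and the vertices from 2 on index it. *)
Lemma face_pairs k j i : j < size k -> 0 < nth 0 k j -> i <= nth 0 k j ->
  [seq face_pair k j i p | p <- pairs (remove1 k j)]
  = delete (sumn (take j k) + (maxn i 1).-1) (pairs k).
Proof.
move=> ltj kj_gt0 lei; have := cat_take_drop j k; rewrite (drop_nth 0 ltj).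
have := size_takel (ltnW ltj).
rewrite /face_pair /face_dir /remove1.
move: (take j k) (drop j.+1 k) (nth 0 k j) kj_gt0 lei
  => k1 k2 x x_gt0 lei s1 <-.
have le_m : 0 < maxn i 1 <= x by rewrite leq_max orbT /= geq_max lei.
have lt_m : (maxn i 1).-1 < x.
  by case/andP: le_m => m_gt0; rewrite -(ltn_predK m_gt0).
rewrite [in RHS]pairs_cat -size_pairs delete_cat.
rewrite -map_delete pairs_cons delete_catl ?size_map ?size_iota // -map_delete.
rewrite delete_iota // pairs_cat !map_cat; congr (_ ++ _).
  rewrite -[RHS]map_id; apply/eq_in_map => -[u a]; rewrite mem_pairs => lea.
  have ltu : u < j.
    rewrite -s1 ltnNge; apply/negP => le; move: lea.
    by rewrite nth_default // leqn0 andbC => /andP[/eqP->].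
  by rewrite /= /bump (leqNgt j) ltu add0n ltn_eqF // if_same.
case: (leqP x 1) => x1.
  have -> : x = 1 by apply/eqP; rewrite eqn_leq x1.
  rewrite /= -!map_comp; apply: eq_map => -[u a] /=.
  by rewrite /bump s1 leq_addr add1n addnS gtn_eqF // ltnS leq_addr.
rewrite pairs_cons map_cat map_cat -!map_comp; congr (_ ++ _).
  apply/eq_in_map => a; rewrite mem_iota => /andP[a_gt0 _] /=.
  rewrite s1 addn0 eqxx; congr (_, _).
  by rewrite /bump geq_max a_gt0 andbT.
apply: eq_map => -[u a] /=.
by rewrite s1 addnS gtn_eqF // ltnS leq_addr.
Qed.

Lemma nth_pairs k j m : j < size k -> 0 < m <= nth 0 k j ->
  nth (0, 0) (pairs k) (sumn (take j k) + m.-1) = (j, m).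
Proof.
move=> ltj le_m; have := cat_take_drop j k; rewrite (drop_nth 0 ltj).
have := size_takel (ltnW ltj).
move: (take j k) (drop j.+1 k) (nth 0 k j) le_m => k1 k2 x le_m s1 <-.
have lt_m : m.-1 < x by case/andP: le_m => m_gt0; rewrite -(ltn_predK m_gt0).
rewrite pairs_cat nth_cat size_pairs ltnNge leq_addr /= addKn.
rewrite (nth_map (0, 0)); last first.
  by rewrite size_pairs /= (leq_trans lt_m) ?leq_addr.
rewrite pairs_cons nth_cat size_map size_iota lt_m.
rewrite (nth_map 0) ?size_iota // nth_iota // add1n /= s1 addn0.
by case/andP: le_m => m_gt0 _; rewrite prednK.
Qed.

Lemma ltn_sumn_take k j m : j < size k -> m < nth 0 k j ->
  sumn (take j k) + m < sumn k.
Proof.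
move=> ltj lt_m; rewrite -[in sumn k](cat_take_drop j k) (drop_nth 0 ltj).
by rewrite sumn_cat /= ltn_add2l (leq_trans lt_m) ?leq_addr.
Qed.

(** * Cramer's rule and directions of convex sets *)

Local Open Scope ring_scope.
Local Open Scope classical_set_scope.

(** Cramer's rule: the t-th entry of adj M * (M w) is det M * w_t, and it only
    involves the cofactor of M at (r, t). *)
Lemma det_minor1 (A : comNzRingType) n (M : 'M[A]_n) (r t : 'I_n)
    (w : 'cV[A]_n) (z : A) :
  row' r (col' t M) = 1%:M -> M *m w = z *: delta_mx r 0 ->
  \det M * w t 0 = (-1) ^+ (r + t) * z.
Proof.
move=> minor1 Mw; transitivity ((\adj M *m (M *m w)) t 0).
  by rewrite mulmxA mul_adj_mx mul_scalar_mx mxE.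
rewrite Mw -scalemxAr mxE -colE !mxE /cofactor minor1 det1 mulr1.
by rewrite mulrC.
Qed.

Section Convex.
Variables (R : realType) (V : vectType R).
Implicit Types (P F : set V) (U : {vspace V}).

Lemma direction_uniq P U U' : is_direction P U -> is_direction P U' -> U = U'.
Proof.
move=> [PU minU] [PU' minU']; apply/eqP; rewrite eqEsubv.
by rewrite minU // minU'.
Qed.

Lemma has_dim_uniq P d d' : has_dim P d -> has_dim P d' -> d = d'.
Proof. by move=> [U PU <-] [U' PU' <-]; rewrite (direction_uniq PU PU'). Qed.

Lemma is_frame_dim P A : is_frame P A -> has_dim P (size A).
Proof.
by case=> U PU /andP[/eqP spanA /eqP freeA]; exists U => //; rewrite -spanA.
Qed.

End Convex.

(** * Parts of the prism supported by a set of coordinates *)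

Section Geometry.
Variables (R : realType) (k : seq nat).
Local Notation C := (prism_coord k).
Local Notation V := (prism_space R k).
Implicit Types (c d : C) (x y z : V) (L : seq C).

(** Evaluation at c as a constant of its own, for the sake of its linear
    structure. *)
Definition entry c (x : V) : R^o := (x : {ffun C -> R^o}) c.

Lemma entry_is_linear c : linear (entry c).
Proof. by move=> a x y; rewrite /entry !ffunE. Qed.
HB.instance Definition _ c :=
  GRing.isLinear.Build R V R^o _ (entry c) (entry_is_linear c).

Lemma eq_entry x y : (forall c, entry c x = entry c y) -> x = y.
Proof. by move=> exy; apply/ffunP. Qed.

Definition unit_vec c : V := [ffun d => (d == c)%:R].

Lemma entry_unit_vec d c : entry d (unit_vec c) = (d == c)%:R.
Proof. by rewrite /entry ffunE. Qed.

Lemma sum_unit_vec x : x = \sum_c entry c x *: unit_vec c.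
Proof.
apply: eq_entry => d.
rewrite linear_sum (bigD1 d) //= linearZ /= entry_unit_vec eqxx.
rewrite big1 ?addr0; first by rewrite -[LHS]mulr1.
by move=> c; rewrite eq_sym linearZ /= entry_unit_vec => /negPf->; exact: mulr0.
Qed.

(** The choice of a vertex in each factor, that is, a vertex of the prism. *)
Definition corner := forall u : 'I_(size k), 'I_(nth 0%N k u).+1.
Implicit Types (b : corner).
Definition corner_coord b u : C := existT _ u (b u).

(** The edge of the prism from the vertex b to the vertex obtained from b by
    moving to c in the part of c; it is 0 when b uses c. *)
Definition edge_vec b c : V := unit_vec c - unit_vec (corner_coord b (tag c)).

Lemma sum_block (F : C -> R) (u : 'I_(size k)) :
  \sum_(a < (nth 0%N k u).+1) F (existT _ u a) = \sum_(c | tag c == u) F c.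
Proof.
have := @sig_big_dep _ _ _ 'I_(size k) (fun u => 'I_(nth 0%N k u).+1)
  (pred1 u) (fun _ _ => true) (fun u a => F (existT _ u a)).
move=> /(_ _ +%R); rewrite (big_pred1 u) //= => ->.
apply: eq_big => [c|[? ?] //].
by rewrite andbT.
Qed.

Lemma prismP x : prism R k x <->
  (forall c, 0 <= entry c x) /\ (forall u, \sum_(c | tag c == u) entry c x = 1).
Proof.
rewrite /prism /std_simplex /=; split=> [Px|[x_ge0 sum1] u].
  split=> [[u a]|u]; first by have [/(_ a)] := Px u.
  by have [_ <-] := Px u; rewrite -(sum_block (fun c => entry c x)).
by split=> [a|]; [exact: x_ge0|rewrite (sum_block (fun c => entry c x))].
Qed.

Lemma block_sum_unit_vec c u :
  \sum_(d | tag d == u) entry d (unit_vec c) = (tag c == u)%:R.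
Proof.
rewrite (eq_bigr (fun d => if d == c then 1 else 0)) => [|d _]; last first.
  by rewrite entry_unit_vec; case: eqP.
rewrite -big_mkcondr /=; case: eqP => [cu|ncu].
  rewrite (big_pred1 c) // => d /=.
  by case: (d =P c) => [->|]; rewrite ?cu ?eqxx ?andbF.
by rewrite big1 // => d /andP[/eqP du /eqP dc]; case: ncu; rewrite -dc.
Qed.

Definition corner_pt b : V := \sum_u unit_vec (corner_coord b u).

Lemma entry_corner_pt b c :
  entry c (corner_pt b) = (c == corner_coord b (tag c))%:R.
Proof.
rewrite linear_sum (bigD1 (tag c)) //= entry_unit_vec big1 ?addr0 // => u neu.
rewrite entry_unit_vec; case: eqP => // e; move: neu; rewrite e eqxx //.
Qed.

Lemma corner_pt_prism b : prism R k (corner_pt b).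
Proof.
apply/prismP; split=> [c|u]; first by rewrite entry_corner_pt ler0n.
rewrite -sum_block (bigD1 (b u)) //= entry_corner_pt eqxx.
rewrite big1 ?addr0 // => a nea.
rewrite entry_corner_pt /= /corner_coord eq_Tagged /=; move: nea; by case: eqP.
Qed.

Definition sub_prism (S : pred C) : set V :=
  [set x | prism R k x /\ forall c, ~~ S c -> entry c x = 0].

Lemma block_sum_diff x y u : prism R k x -> prism R k y ->
  \sum_(c | tag c == u) entry c (x - y) = 0.
Proof.
move=> /prismP[_ sx] /prismP[_ sy].
by under eq_bigr do rewrite linearB /=; rewrite sumrB sx sy subrr.
Qed.

(** As z has sum 0 in each block, the terms in unit_vec (corner_coord b u)
    cancel when the sum is extended to all coordinates; the added terms vanish
    by the hypothesis on z, or because edge_vec b c = 0. *)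
Lemma edge_vec_expansion b L z :
  (forall u, \sum_(c | tag c == u) entry c z = 0) -> uniq L ->
  (forall c, c \notin L -> c != corner_coord b (tag c) -> entry c z = 0) ->
  z = \sum_(c <- L) entry c z *: edge_vec b c.
Proof.
move=> sz UL zL; rewrite big_uniq //=.
have -> : \sum_(c in L) entry c z *: edge_vec b c
  = \sum_c entry c z *: edge_vec b c.
  rewrite [RHS](bigID [in L]) /= [X in _ + X]big1 ?addr0 // => c cL.
  case: (eqVneq c (corner_coord b (tag c))) => [e|ne]; last first.
    by rewrite zL ?scale0r.
  by rewrite /edge_vec -e subrr scaler0.
under eq_bigr do rewrite scalerBr.
rewrite sumrB -sum_unit_vec.
rewrite (partition_big (@tag _ _) predT) //= big1 ?subr0 // => u _.
rewrite (eq_bigr (fun c => entry c z *: unit_vec (corner_coord b u)))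
  => [|c /eqP-> //].
by rewrite -scaler_suml sz scale0r.
Qed.

Lemma entry_edge_vec b L c d :
  (forall c, c \in L -> c != corner_coord b (tag c)) ->
  d \in L -> entry d (edge_vec b c) = (d == c)%:R.
Proof.
move=> Lb dL; rewrite linearB /= !entry_unit_vec.
case: (d =P corner_coord b (tag c)) => [e|_].
  by have := Lb d dL; rewrite e eqxx.
by rewrite subr0.
Qed.

(** The entries at the elements of L form a dual basis. *)
Lemma edge_vec_free b L :
  uniq L -> (forall c, c \in L -> c != corner_coord b (tag c)) ->
  free [seq edge_vec b c | c <- L].
Proof.
elim: L => [|c L IHL] /=; first by rewrite nil_free.
move=> /andP[cL UL] Lb; rewrite free_cons IHL ?andbT //; last first.
  by move=> d dL; apply: Lb; rewrite inE dL orbT.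
apply/negP => cspan.
have := congr1 (entry c)
  (@coord_span _ _ _ (in_tuple [seq edge_vec b d | d <- L]) _ cspan).
rewrite (entry_edge_vec c Lb) ?inE ?eqxx // linear_sum /=.
rewrite big1 => [/eqP|i _].
  by rewrite oner_eq0.
have /mapP[d dL ->] := mem_nth 0 (ltn_ord i).
rewrite linearZ /= (entry_edge_vec d Lb) ?inE ?eqxx //.
case: eqP => [ecd|_]; last exact: mulr0.
by rewrite ecd dL in cL.
Qed.

Lemma neighbour_prism b c :
  c != corner_coord b (tag c) -> prism R k (corner_pt b + edge_vec b c).
Proof.
move=> neqc.
have neq : (corner_coord b (tag c) == c) = false by rewrite eq_sym (negPf neqc).
have /prismP[_ ptsum] := corner_pt_prism b.
apply/prismP; split=> [d|u].
  rewrite linearD linearB /= entry_corner_pt !entry_unit_vec.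
  case: (d =P corner_coord b (tag c)) => [->|_].
    by rewrite /= eqxx neq add0r subrr.
  by rewrite subr0 addr_ge0 ?ler0n.
under eq_bigr do rewrite linearD linearB /=.
by rewrite big_split /= sumrB !block_sum_unit_vec ptsum subrr addr0.
Qed.

(** Every difference of points of the part expands in these edges, and each edge
    is a difference of two vertices of the part. *)
Lemma sub_prism_frame (S : pred C) b L :
  (forall u, S (corner_coord b u)) -> uniq L ->
  (forall c, (c \in L) = S c && (c != corner_coord b (tag c))) ->
  is_frame (sub_prism S) [seq edge_vec b c | c <- L].
Proof.
move=> Sb UL LE; exists <<[seq edge_vec b c | c <- L]>>%VS; last first.
  rewrite /basis_of eqxx edge_vec_free // => c.
  by rewrite LE => /andP[].
split=> [x y [Px Sx] [Py Sy]|U PU].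
  rewrite (@edge_vec_expansion b L (x - y)) //; first last.
  - move=> c; rewrite LE negb_and => /orP[nS _|/negPf-> //].
    by rewrite linearB /= Sx // Sy // subrr.
  - by move=> u; exact: block_sum_diff.
  rewrite big_seq; apply: memv_suml => c cL; apply/memvZ/memv_span.
  exact: map_f.
apply/span_subvP => v /mapP[c]; rewrite LE => /andP[Sc neqc ->].
have -> : edge_vec b c = corner_pt b + edge_vec b c - corner_pt b.
  by rewrite addrC addKr.
apply: PU; split; first 1 last.
- move=> d nSd; rewrite linearD linearB /= entry_corner_pt !entry_unit_vec.
  have nd u : (d == corner_coord b u) = false by apply: contraNF nSd => /eqP->.
  have -> : (d == c) = false by apply: contraNF nSd => /eqP->.
  by rewrite !nd subrr addr0.
- exact: corner_pt_prism.
- move=> d nSd; rewrite entry_corner_pt.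
  have -> // : (d == corner_coord b (tag d)) = false.
  by apply: contraNF nSd => /eqP->.
exact: neighbour_prism.
Qed.

Lemma sub_prism_corner (S : pred C) b : (forall u, S (corner_coord b u)) ->
  sub_prism S (corner_pt b).
Proof.
move=> Sb; split=> [|d nSd]; first exact: corner_pt_prism.
have /negPf ned : d != corner_coord b (tag d) by apply: contraNneq nSd => ->.
by rewrite entry_corner_pt ned.
Qed.

Lemma prismE : prism R k = sub_prism predT.
Proof. by apply/seteqP; split=> x => [Px|[]//]; split. Qed.

Lemma prism_faceE c : prism_face R (tagged c) = sub_prism (predC1 c).
Proof.
case: c => u a; apply/seteqP; split=> x [Px xS]; split=> //.
  by move=> c /negPn/eqP->.
by apply: (xS (existT _ u a)); apply/negPn/eqP.
Qed.

Definition origin_corner : corner := fun u => ord0.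

Hypothesis k_gt0 : forall j : 'I_(size k), (0 < nth 0%N k j)%N.

(** The first vertex of the facet opposite to c: the origin, with the vertex 0
    replaced by 1 in the part of c when c is the vertex 0 of that part. *)
Definition avoiding_corner c : corner :=
  fun u => inord
    (if u == tag c then nat_of_bool (tagged c == 0%N :> nat) else 0)%N.

Lemma val_avoiding_corner c u :
  avoiding_corner c u
  = (if u == tag c then nat_of_bool (tagged c == 0%N :> nat) else 0)%N :> nat.
Proof.
rewrite inordK // ltnS; case: ifP => // /eqP->.
by apply: leq_trans (k_gt0 _); case: eqP.
Qed.

Lemma avoiding_corner_neq c u : corner_coord (avoiding_corner c) u != c.
Proof.
apply/negP => /eqP e; have := val_avoiding_corner c u.
have /= eu := congr1 tag e.
have /= -> := congr1 (fun d : C => tagged d : nat) e.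
by rewrite eu eqxx; case: (tagged c : nat).
Qed.

(** The facet opposite to c has a vertex that uses the coordinate d, unless
    c = d. *)
Lemma prism_face_inj c d :
  prism_face R (tagged c) = prism_face R (tagged d) -> c = d.
Proof.
rewrite !prism_faceE => ecd; apply/eqP/negPn/negP => necd.
(* The vertex d in the part of d, and away from c in the other parts; the cast
   only changes the dependent type of the vertex. *)
pose b : corner := fun u => if u =P tag d is ReflectT e
  then cast_ord
    (congr1 (fun v : 'I_(size k) => (nth 0%N k v).+1) (esym e)) (tagged d)
  else avoiding_corner c u.
have bd : corner_coord b (tag d) = d.
  rewrite /corner_coord /b; case: eqP => // e.
  by rewrite (eq_irrelevance e erefl) cast_ord_id; case: (d).
have : sub_prism (predC1 c) (corner_pt b).
  apply: sub_prism_corner => u /=; case: (u =P tag d) => [->|neu].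
    by rewrite bd eq_sym.
  by rewrite /corner_coord /b; case: eqP => // _; exact: avoiding_corner_neq.
rewrite ecd => -[_ /(_ d)].
rewrite /= eqxx entry_corner_pt bd eqxx => /(_ isT) /eqP.
by rewrite oner_eq0.
Qed.

(** The gap between the maximum m u of phi over the vertices of each factor and
    its value at x is a sum of nonnegative terms, which vanish exactly when the
    nonzero entries of x are at coordinates with maximal value. *)
Lemma argmax_sub_prism (phi : {linear V -> R^o}) :
  exists b (S : pred C), (forall u, S (corner_coord b u)) /\
    [set x | prism R k x /\ forall y, prism R k y -> phi y <= phi x]
    = sub_prism S.
Proof.
pose w c := phi (unit_vec c).
pose b : corner := fun u => [arg max_(a > ord0) (w (existT _ u a) : R)]%O.
pose m u := w (corner_coord b u).
have le_wm c : w c <= m (tag c).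
  case: c => u a; rewrite /m /corner_coord /b /=.
  by case: arg_maxP => // a' _ /(_ a isT).
have gap x : prism R k x ->
    phi (corner_pt b) - phi x = \sum_c entry c x * (m (tag c) - w c).
  move=> /prismP[_ sum1].
  under [RHS]eq_bigr do rewrite mulrBr.
  rewrite sumrB; congr (_ - _); last first.
    rewrite {1}(sum_unit_vec x) linear_sum; apply: eq_bigr => c _.
    by rewrite linearZ.
  rewrite linear_sum (partition_big (@tag _ _) predT) //=.
  apply: eq_bigr => u _.
  rewrite (eq_bigr (fun c => entry c x * m u)) => [|c /eqP-> //].
  by rewrite -mulr_suml sum1 mul1r.
have gap_ge0 x : prism R k x -> forall c, 0 <= entry c x * (m (tag c) - w c).
  by move=> /prismP[x_ge0 _] c; rewrite mulr_ge0 // subr_ge0.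
exists b, (fun c => w c == m (tag c)); split=> [u|]; first exact: eqxx.
apply/seteqP; split=> x [Px xmax]; split=> //.
  move=> c nSc; have := xmax _ (corner_pt_prism b).
  rewrite -subr_le0 gap // => sum_le0.
  have /eqP : \sum_c entry c x * (m (tag c) - w c) = 0.
    apply/eqP; rewrite eq_le sum_le0 sumr_ge0 // => d _; exact: gap_ge0.
  rewrite psumr_eq0 => [/allP/(_ c)|d _]; last exact: gap_ge0.
  rewrite mem_index_enum => /(_ isT); rewrite mulf_eq0 subr_eq0 eq_sym.
  by rewrite [m _ == _]eq_sym (negPf nSc) orbF eq_sym => /eqP.
move=> y Py; have -> : phi x = phi (corner_pt b).
  apply/esym/eqP; rewrite -subr_eq0 gap // big1 // => c _.
  have [->|/xmax->] := eqVneq (w c) (m (tag c)); first by rewrite subrr mulr0.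
  by rewrite mul0r.
by rewrite -subr_ge0 gap // sumr_ge0 // => c _; exact: gap_ge0.
Qed.

End Geometry.

(** * Frames and orientation of the facets *)

Section Frames.
Variables (R : realType) (k : seq nat).
Local Notation C := (prism_coord k).
Local Notation V := (prism_space R k).
Implicit Types (c d : C) (x y z : V) (coords : seq C) (b : corner k).
Hypothesis k_gt0 : forall j : 'I_(size k), (0 < nth 0%N k j)%N.

Definition coord_pair c : nat * nat := (tag c : nat, tagged c : nat).

Lemma coord_pair_inj : injective coord_pair.
Proof.
move=> [u a] [v a'] [/= /val_inj euv]; case: _ / euv a' => a' /val_inj ->.
by [].
Qed.

Lemma coord_pair_lift (s : seq (nat * nat)) :
  {subset s <= pairs k} -> exists coords, [seq coord_pair c | c <- coords] = s.
Proof.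
elim: s => [|[u a] s IHs] sub; first by exists [::].
have [p ps|coords <-] := IHs; first by apply: sub; rewrite inE ps orbT.
have := sub _ (mem_head _ _); rewrite mem_pairs => /andP[a_gt0 lea].
have ltu : (u < size k)%N.
  rewrite ltnNge; apply/negP => le; move: lea.
  by rewrite nth_default // leqNgt a_gt0.
have lta : (a < (nth 0%N k (Ordinal ltu)).+1)%N by [].
by exists (existT _ (Ordinal ltu) (Ordinal lta) :: coords).
Qed.

Lemma product_frameE k' (f : seq nat -> V) : product_frame k' f =
  [seq f (set_nth 0%N (nseq (size k') 0%N) p.1 p.2) - f (nseq (size k') 0%N)
  | p <- pairs k'].
Proof. by rewrite /product_frame map_allpairs. Qed.

(** The map h tells at which coordinate of the big prism a vector of the frame
    of k' ends, and b from which vertex it starts; k' = k for the prism,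
    and k' = remove1 k j for a facet. *)
Lemma product_frame_edge_vec k' (f : seq nat -> V)
    (h : nat * nat -> nat * nat) b coords :
  (forall u a c, (0 < a <= nth 0%N k' u)%N -> coord_pair c = h (u, a) ->
     f (set_nth 0%N (nseq (size k') 0%N) u a) - f (nseq (size k') 0%N)
     = edge_vec R b c) ->
  [seq coord_pair c | c <- coords] = [seq h p | p <- pairs k'] ->
  product_frame k' f = [seq edge_vec R b c | c <- coords].
Proof.
move=> fE; rewrite product_frameE.
have: forall u a, (u, a) \in pairs k' -> (0 < a <= nth 0%N k' u)%N.
  by move=> u a; rewrite mem_pairs.
elim: (pairs k') coords => [|[u a] s IHs] [|c coords] //= sP [ec eL].
rewrite (fE u a c) ?ec //; last by apply: sP; rewrite mem_head.
by rewrite (IHs coords) // => v a' va'; apply: sP; rewrite inE va' orbT.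
Qed.

Lemma entry_vertex_point d p :
  entry d (vertex_point R k p) = (tagged d == nth 0%N p (tag d) :> nat)%:R.
Proof. by rewrite /entry ffunE. Qed.

Lemma eq_coord_pair c d :
  (d == c) = (tag d == tag c) && (tagged d == tagged c :> nat).
Proof. by rewrite -(inj_eq coord_pair_inj) xpair_eqE. Qed.

Lemma coord_pair_corner b u :
  coord_pair (corner_coord b u) = (u : nat, b u : nat).
Proof. by []. Qed.

Lemma nth_axis n u a v :
  nth 0%N (set_nth 0%N (nseq n 0%N) u a) v = if v == u then a else 0%N.
Proof. by rewrite nth_set_nth /= nth_nseq if_same. Qed.

Lemma axis_vertex k' u a : (0 < a <= nth 0%N k' u)%N ->
  is_vertex k' (set_nth 0%N (nseq (size k') 0%N) u a).
Proof.
move=> /andP[a_gt0 lea]; apply/is_vertexP; split=> [|v]; last first.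
  by rewrite nth_axis; case: eqP => [->|].
rewrite size_set_nth size_nseq; apply/maxn_idPr; rewrite ltnNge.
by apply/negP => le; move: lea; rewrite nth_default // leqNgt a_gt0.
Qed.

Lemma origin_vertex k' : is_vertex k' (nseq (size k') 0%N).
Proof.
by apply/is_vertexP; split=> [|v]; rewrite ?size_nseq ?nth_nseq ?if_same.
Qed.

Lemma diff_vertex_point b c (p q : seq nat) :
  (forall d, tag d != tag c -> nth 0%N p (tag d) = nth 0%N q (tag d)) ->
  nth 0%N p (tag c) = tagged c -> nth 0%N q (tag c) = b (tag c) ->
  vertex_point R k p - vertex_point R k q = edge_vec R b c.
Proof.
move=> epq pc qc; apply: eq_entry => d.
rewrite !linearB /= !entry_vertex_point !entry_unit_vec !(eq_coord_pair _ d) /=.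
have [edc|ndc] := eqVneq (tag d) (tag c).
  move: (tagged d : nat) => a; have -> : (tag d : nat) = tag c by rewrite edc.
  by rewrite pc qc.
by rewrite epq // !subrr.
Qed.

(* The index sequence of the frame of the prism, lifted from pairs of numbers to
   coordinates of the prism. *)
Section FrameCoordinates.
Variable coords : seq C.
Hypothesis LE : [seq coord_pair c | c <- coords] = pairs k.

Lemma prism_frameE :
  prism_frame R k = [seq edge_vec R (@origin_corner k) c | c <- coords].
Proof.
apply: (@product_frame_edge_vec _ _ id); last by rewrite LE map_id.
move=> u a c lea [eu ea]; apply: diff_vertex_point => [d ndc||].
- rewrite nth_axis nth_nseq if_same; case: eqP => // edu.
  by case/eqP: ndc; apply: val_inj; exact: etrans edu (esym eu).
- by rewrite nth_axis ea eu eqxx.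
- by rewrite nth_nseq if_same.
Qed.

Lemma coords_uniq : uniq coords.
Proof. by rewrite -(map_inj_uniq coord_pair_inj) LE pairs_uniq. Qed.

Lemma size_coords : size coords = sumn k.
Proof. by rewrite -(size_map coord_pair) LE size_pairs. Qed.

Lemma mem_coords c : (c \in coords) = (0 < (tagged c : nat))%N.
Proof.
rewrite -(mem_map coord_pair_inj) LE mem_pairs.
by rewrite -(ltnS (tagged c)) ltn_ord andbT.
Qed.

Lemma mem_coords_corner c :
  (c \in coords) = (c != corner_coord (@origin_corner k) (tag c)).
Proof. by rewrite mem_coords eq_coord_pair eqxx lt0n. Qed.

Lemma is_frame_prism : is_frame (prism R k) (prism_frame R k).
Proof.
rewrite prism_frameE prismE; apply: sub_prism_frame => //.
- exact: coords_uniq.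
- exact: mem_coords_corner.
Qed.

Variables (j : 'I_(size k)) (i : 'I_(nth 0%N k j).+1).
Let cface : C := existT _ j i.
(* (j, m) is the index of the only vector of the frame of the prism without
   counterpart in the frame of the facet, and t is its position. *)
Let m := maxn i 1.
Let t := (sumn (take j k) + m.-1)%N.

Let lei : (i <= nth 0%N k j)%N. Proof. by rewrite -ltnS. Qed.
Let le_m : (0 < m <= nth 0%N k j)%N.
Proof. by rewrite leq_max orbT /= geq_max lei k_gt0. Qed.

Lemma ltn_removed : (t < size coords)%N.
Proof.
rewrite size_coords ltn_sumn_take //.
by case/andP: le_m => m_gt0; rewrite -[m in (m <= _)%N](ltn_predK m_gt0).
Qed.

Definition face_coords := delete t coords.

Lemma face_coordsE : [seq coord_pair c | c <- face_coords]
  = [seq face_pair k j i p | p <- pairs (remove1 k j)].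
Proof. by rewrite map_delete LE face_pairs. Qed.

Lemma nth_removed c0 : coord_pair (nth c0 coords t) = (j : nat, m).
Proof. by rewrite -(nth_map c0 (0, 0)%N) ?ltn_removed // LE nth_pairs. Qed.

Lemma mem_face_coords c : (c \in face_coords)
  = (c != cface) && (c != corner_coord (avoiding_corner cface) (tag c)).
Proof.
rewrite (mem_delete cface) ?ltn_removed ?coords_uniq // mem_coords.
rewrite -(inj_eq coord_pair_inj c (nth _ _ _)) nth_removed.
rewrite !eq_coord_pair eqxx /=.
rewrite val_avoiding_corner // xpair_eqE /= /m.
have -> : (tag c == j :> nat) = (tag c == j) by [].
case: eqP => _ /=; last by rewrite lt0n andbT.
case: (i : nat) => [|i'] /=; first by rewrite !lt0n.
by rewrite (maxn_idPl (ltn0Sn i')) lt0n andbC.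
Qed.

Lemma face_coords_uniq : uniq face_coords.
Proof. exact: delete_uniq coords_uniq. Qed.

Lemma face_frameE :
  face_frame R i
  = [seq edge_vec R (avoiding_corner cface) c | c <- face_coords].
Proof.
apply: (product_frame_edge_vec _ face_coordsE) => u a c lea [eu ea].
have vp := axis_vertex lea; have v0 := origin_vertex (remove1 k j).
have fd v : (v == face_dir k j u)
  = (v == j) && (nth 0%N k j > 1)%N && (u == j)
    || (v != j) && ((if (nth 0%N k j <= 1)%N then unbump j v else v) == u).
  rewrite /face_dir; case: (leqP (nth 0%N k j) 1) => kj1.
    have [->|nvj] := eqVneq v j; first by rewrite (negPf (neq_bump _ _)).
    by rewrite /= -(can_eq (bumpK j) (unbump j v)) unbumpKcond (negPf nvj).
  by have [->|nvj] := eqVneq v j; rewrite /= ?orbF // eq_sym.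
apply: diff_vertex_point => [d ndc||].
- rewrite !face_vertexE // !nth_axis !nth_nseq !if_same.
  have : (tag d == face_dir k j u :> nat) = false.
    by rewrite -eu; apply/negbTE.
  rewrite fd; have [->|ndj] := eqVneq (tag d : nat) j; last by move=> /= ->.
  by case: leqP => //= _; rewrite orbF eq_sym => ->.
- rewrite face_vertexE // !nth_axis ea /= eu.
  have := fd (face_dir k j u); rewrite eqxx => /esym.
  case: (eqVneq (face_dir k j u) j) => [e|ne] /=; last by move=> ->.
  by rewrite orbF => /andP[kj1 /eqP ->]; rewrite leqNgt kj1 eqxx.
- rewrite face_vertexE // nth_nseq if_same val_avoiding_corner //.
  by rewrite !nth_nseq !if_same /bump addn0 leqn0.
Qed.

Lemma is_frame_face : is_frame (prism_face R i) (face_frame R i).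
Proof.
rewrite face_frameE (prism_faceE R cface); apply: sub_prism_frame => //.
- by move=> u; exact: avoiding_corner_neq.
- exact: face_coords_uniq.
- exact: mem_face_coords.
Qed.

Lemma block_sum_edge_vec b c u :
  \sum_(d | tag d == u) entry d (edge_vec R b c) = 0.
Proof.
under eq_bigr do rewrite linearB /=.
by rewrite sumrB !block_sum_unit_vec subrr.
Qed.

(** All the frame vectors of the facet have entry 0 at (j, i), and only the
    outward vector x - y has a nonzero entry there, which is negative.  This is
    the equation M w = entry cface z * delta_mx r0 0 that Cramer's rule needs,
    where w lists the entries at (j, i) of the frame of the prism. *)
Lemma orientation_face x y : prism_face R i x -> prism R k y ->
  ~ prism_face R i y ->
  relative_orientation (prism_frame R k) (x - y :: face_frame R i)
    ((-1) ^+ (sumn (take j k) + i)).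
Proof.
move=> [Px xi] Py nFy; have n_gt0 := ltn_removed.
set z := x - y; rewrite face_frameE prism_frameE.
set A := [seq edge_vec R (@origin_corner k) c | c <- coords].
set B := [seq edge_vec R _ c | c <- face_coords].
have sA : size A = size coords by rewrite size_map.
have sB : size B = (size A).-1 by rewrite size_map size_delete ?size_map.
have A_gt0 : (0 < size A)%N by rewrite sA (leq_trans _ n_gt0).
have ltA : (t < size A)%N by rewrite sA.
pose r0 := Ordinal A_gt0; pose t0 := Ordinal ltA.
have zF : entry cface z < 0.
  have [y_ge0 _] := (prismP y).1 Py.
  rewrite linearB /= [entry cface x]xi sub0r oppr_lt0.
  rewrite lt_neqAle y_ge0 andbT eq_sym.
  by apply/eqP => yF; apply: nFy; split.
have block0 v u : v \in z :: B -> \sum_(c | tag c == u) entry c v = 0.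
  rewrite inE => /orP[/eqP->|/mapP[c _ ->]]; last exact: block_sum_edge_vec.
  exact: block_sum_diff.
split; first by rewrite /= sB prednK.
pose M :=
  \matrix_(r < size A, c < size A) (entry (nth cface coords c) (z :: B)`_r : R).
have expand (r : 'I_(size A)) : (z :: B)`_r = \sum_(c < size A) M r c *: A`_c.
  have rB : (z :: B)`_r \in z :: B by rewrite mem_nth //= sB prednK.
  rewrite {1}(@edge_vec_expansion _ _ (@origin_corner k) coords ((z :: B)`_r))
    ?coords_uniq //.
  - rewrite (big_nth cface) big_mkord -sA; apply: eq_bigr => c _.
    by rewrite mxE (nth_map cface) // -sA.
  - by move=> u; exact: block0.
  - by move=> c; rewrite mem_coords_corner => /negPf->.
exists M => //.
pose w : 'cV[R]_(size A) := \col_c entry cface A`_c.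
have Mw : M *m w = entry cface z *: delta_mx r0 0.
  apply/colP => r; rewrite !mxE eqxx andbT.
  transitivity (entry cface (z :: B)`_r : R).
    rewrite [in RHS]expand linear_sum; apply: eq_bigr => c _.
    by rewrite linearZ /= !mxE.
  have [->|] := eqVneq r r0; first by rewrite mulr1.
  rewrite mulr0; case: r => -[|r] //= ltr _.
  have ltrL : (r < size face_coords)%N.
    rewrite -(size_map (edge_vec R (avoiding_corner cface))) -/B sB.
    by rewrite -ltnS prednK.
  rewrite (nth_map cface) //.
  have := mem_nth cface ltrL; rewrite mem_face_coords => /andP[necF _].
  rewrite linearB /= !entry_unit_vec eq_sym (negPf necF) [cface == _]eq_sym.
  by rewrite (negPf (avoiding_corner_neq k_gt0 _ _)) subrr.
have minor : row' r0 (col' t0 M) = 1%:M.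
  apply/matrixP => a b.
  rewrite !mxE /= add0n -(nth_delete cface b n_gt0) -/face_coords.
  have sL' : size face_coords = (size A).-1 by rewrite -sB size_map.
  rewrite (nth_map cface) ?sL' //.
  rewrite (@entry_edge_vec _ _ _ face_coords) ?mem_nth ?sL' //.
    by rewrite nth_uniq ?sL' ?face_coords_uniq // eq_sym.
  by move=> c; rewrite mem_face_coords => /andP[].
have := det_minor1 minor Mw; rewrite mxE (nth_map cface) ?ltn_removed //= add0n.
have e_t := nth_removed cface.
rewrite linearB /= !entry_unit_vec -!(inj_eq coord_pair_inj).
rewrite e_t coord_pair_corner.
have -> : tag (nth cface coords t) = j by apply: val_inj; case: e_t.
rewrite /= !xpair_eqE !eqxx /= /m /t.
have zFN : Num.sg (entry cface z : R) = -1 by rewrite ltr0_sg.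
(* The t-th vector of the frame of the prism is the edge from (j, 0) to (j, 1)
   when i = 0, and to (j, i) otherwise. *)
have [i0|i_gt0] := posnP i.
  rewrite i0 /= sub0r mulrN1 /m i0 /= !addn0 => /eqP.
  rewrite eqr_oppLR => /eqP->.
  by rewrite sgrN sgrM sgrX sgrN1 zFN mulrN1 opprK.
rewrite /m (maxn_idPl i_gt0) eqxx /= subr0 mulr1 => ->.
by rewrite sgrM sgrX sgrN1 zFN -exprSr -addnS prednK.
Qed.

Lemma boundary_sign_face :
  boundary_sign (prism R k) (prism_frame R k) (prism_face R i) (face_frame R i)
    ((-1) ^+ (sumn (take j k) + i)).
Proof.
split; [exact: is_frame_prism|exact: is_frame_face|].
exact: orientation_face.
Qed.

Lemma has_dim_face : has_dim (prism_face R i) (sumn k).-1.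
Proof.
have := is_frame_dim is_frame_face.
by rewrite face_frameE size_map size_delete ?ltn_removed // size_coords.
Qed.

Lemma has_dim_prism : has_dim (prism R k) (sumn k).
Proof.
have := is_frame_dim is_frame_prism.
by rewrite prism_frameE size_map size_coords.
Qed.

End FrameCoordinates.

Lemma exists_coords : exists coords, [seq coord_pair c | c <- coords] = pairs k.
Proof. exact: coord_pair_lift. Qed.

(** The linear form is minus the entry at c, maximal where this entry is 0. *)
Lemma codim1_prism_face c :
  is_codim1_face (prism R k) (prism_face R (tagged c)).
Proof.
have [coords LE] := exists_coords.
have facept : prism_face R (tagged c) (corner_pt R (avoiding_corner c)).
  rewrite prism_faceE; apply: sub_prism_corner => u.
  exact: avoiding_corner_neq.
split; first split.
- by exists (corner_pt R (avoiding_corner c)).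
- exists (\- (entry c)); rewrite prism_faceE; apply/seteqP; split=> x [Px xmax].
    split=> // y /prismP[y_ge0 _] /=.
    by rewrite (xmax c) ?oppr0 ?oppr_le0 //= eqxx.
  split=> // d /negPn/eqP->; have [x_ge0 _] := (prismP x).1 Px.
  move: facept; rewrite prism_faceE => -[Ppt /(_ c)].
  rewrite /= eqxx => /(_ isT) pt0.
  have := xmax _ Ppt; rewrite /= pt0 oppr0 oppr_ge0 => x_le0.
  by apply/eqP; rewrite eq_le x_le0 x_ge0.
exists (sumn k).-1; last exact: (has_dim_face LE).
have k_pos : (0 < sumn k)%N.
  by rewrite -(size_coords LE) (leq_trans _ (ltn_removed LE (tagged c))).
by rewrite prednK //; exact: (has_dim_prism LE).
Qed.

(** The face is the part supported by a set S of coordinates.  S omits some c0,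
    for otherwise the face would be the prism, of larger dimension.  If it
    omitted another c, then edge_vec b c would be parallel to the facet opposite
    to c0, hence to the face for reasons of dimension, although all the vectors
    parallel to the face have entry 0 at c. *)
Lemma codim1_faceP F : is_codim1_face (prism R k) F ->
  exists c, F = prism_face R (tagged c).
Proof.
have [coords LE] := exists_coords.
move=> [[[x0 Fx0] [phi FE]] [d Pdim Fdim]].
have [b [S [Sb SE]]] := argmax_sub_prism phi.
have {FE SE} FS : F = sub_prism S by rewrite FE.
have dE : d.+1 = sumn k := has_dim_uniq Pdim (has_dim_prism LE).
have [c0 nSc0] : exists c, ~~ S c.
  apply/not_existsP => nS; have := has_dim_uniq Pdim.
  have -> : prism R k = F.
    rewrite FS; apply/seteqP; split=> [x Px|x []//]; split=> // c nSc.
    by case: (nS c).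
  by move=> /(_ _ Fdim) /eqP; rewrite -[X in _ == X]addn0 -addn1 eqn_add2l.
exists c0; rewrite prism_faceE FS.
suff SE c : S c = (c != c0).
  by apply/seteqP; split=> x [Px xS]; split=> // c; have := xS c; rewrite /= SE.
have [->|nec] := eqVneq c c0; first exact: negbTE.
apply/negPn/negP => nSc.
have [U0 U0dir U0dim] := has_dim_face LE (tagged c0).
have [U Udir Udim] := Fdim.
have F0 x : F x -> prism_face R (tagged c0) x.
  rewrite FS prism_faceE => -[Px xS]; split=> // e /negPn/eqP->.
  exact: xS.
(* U0 is the direction of the facet opposite to c0. *)
have UU0 : U = U0.
  apply/eqP; rewrite eqEdim U0dim Udim -dE /= leqnn andbT.
  by apply: Udir.2 => x y Fx Fy; apply: U0dir.1; exact: F0.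
have neb : c != corner_coord b (tag c) by apply: contraNneq nSc => ->.
have nb0 u : c0 != corner_coord b u by apply: contraNneq nSc0 => ->.
have vU : edge_vec R b c \in U.
  have -> : edge_vec R b c = corner_pt R b + edge_vec R b c - corner_pt R b.
    by rewrite addrC addKr.
  rewrite UU0; apply: U0dir.1; rewrite prism_faceE; split.
  - exact: neighbour_prism.
  - move=> e /negPn/eqP->.
    rewrite linearD linearB /= entry_corner_pt !entry_unit_vec.
    by rewrite !(negPf (nb0 _)) [c0 == c]eq_sym (negPf nec) subrr addr0.
  - exact: corner_pt_prism.
  - by move=> e /negPn/eqP->; rewrite entry_corner_pt (negPf (nb0 _)).
have : (U <= lker (linfun (entry c)))%VS.
  apply: Udir.2 => x y; rewrite FS => -[_ xS] [_ yS].
  by rewrite memv_ker lfunE /= linearB /= xS // yS // subrr.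
move=> /subvP/(_ _ vU); rewrite memv_ker lfunE linearB /= !entry_unit_vec eqxx.
by rewrite (negPf neb) subr0 oner_eq0.
Qed.

End Frames.

Theorem theorem4p3 (R : realType) (G : shalgebra) (k : seq nat)
    (k_neq0 : (0 < size k)%N)
    (k_gt0 : forall j : 'I_(size k), (0 < nth 0%N k j)%N)
    (g : blocks G k) :
  (forall F : set (prism_space R k),
     is_codim1_face (prism R k) F <->
     exists! c : prism_coord k, F = prism_face R (tagged c)) /\
  (forall (j : 'I_(size k)) (i : 'I_(nth 0%N k j).+1),
     [/\ has_dim (prism_face R i) (sumn k).-1,
         boundary_sign (prism R k) (prism_frame R k)
           (prism_face R i) (face_frame R i)
           ((-1) ^+ (sumn (take j k) + i)) &
         forall e : edge (remove1 k j),
           good_label g (face_edge i (k_gt0 j) e)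
           = good_label (face_map i g) e]).
Proof.
have [coords LE] := exists_coords k.
split=> [F|j i]; first split.
- move=> /(codim1_faceP k_gt0)[c FE]; exists c; split=> // d.
  by rewrite FE; exact: prism_face_inj.
- by move=> [c [-> _]]; exact: codim1_prism_face.
split.
- exact: (has_dim_face R k_gt0 LE i).
- exact: (boundary_sign_face R k_gt0 LE i).
- exact: good_label_face.
Qed.
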